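(* For every $d\in\mathbb{N}$, every $R,\beta>0$ and every $0<\epsilon\le\beta R^2$, $$N_{\epsilon,\mathrm{det-ad}}^{\mathrm{val}}(d,R,\beta)\le (d+1)\left\lceil 2\sqrt{\frac{\beta R^2}{\epsilon}}\right\rceil\le 6d\sqrt{\frac{\beta R^2}{\epsilon}}.$$ Moreover, the first bound is achieved by a deterministic adaptive algorithm (with $(d+1)\lceil 2\sqrt{\beta R^2/\epsilon}\rceil$ calls and worst-case error at most $\epsilon$ over $\mathcal F_\beta(d,R)$) all of whose oracle calls lie in $B_2^d(R)$ and whose output lies in $B_2^d(R/2)$.
   Context: Here $\mathbb N$ is the set of positive integers, $\mathbb N_0=\mathbb N\cup\{0\}$, $\|\cdot\|_2$ is the Euclidean norm on $\mathbb{R}^d$, $B_2^d(r)=\{x\in\mathbb{R}^d:\|x\|_2\le r\}$, and $X:=B_2^d(R)$. Objective class: $\mathcal F_\beta(d,R)$ is the set of all functions $f:\mathbb{R}^d\to\mathbb{R}$ such that (i) $f$ is convex and continuously differentiable; (ii) $\nabla f$ is globally $\beta$-Lipschitz in Euclidean norm; (iii) $f$ has a unique global minimizer $x_f^\star\in B_2^d(R/2)$. Write $f^\star=\min_x f(x)$. Algorithms: a deterministic adaptive algorithm with budget $T$ (a $T$-call algorithm) consists of Borel maps $Q_t:(X\times\mathbb{R})^{t-1}\to X$, $t=1,\dots,T$, and a Borel terminal map $Q_{\mathrm{out}}:(X\times\mathbb{R})^T\to X$; these may depend on the public parameters $(d,R,\beta,\epsilon)$. Run on a fixed objective $f$, it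 recursively produces the queries (oracle calls) $x_t=Q_t((x_1,f(x_1)),\dots,(x_{t-1},f(x_{t-1})))$ and the output $\widehat x=\widehat x_f=Q_{\mathrm{out}}((x_1,f(x_1)),\dots,(x_T,f(x_T)))$. Complexity: for $\epsilon>0$, $N_{\epsilon,\mathrm{det-ad}}^{\mathrm{val}}(d,R,\beta)$ is the infimum (with $\inf\varnothing=+\infty$) of all $T\in\mathbb{N}_0$ for which there exists a deterministic adaptive $T$-call algorithm such that $\sup_{f\in\mathcal F_\beta(d,R)}[f(\widehat x_f)-f^\star]\le\epsilon$. *)

(* Defs.v *)
From HB Require Import structures.
From mathcomp Require Import all_boot all_order all_algebra.
From mathcomp Require Import all_classical all_reals all_analysis.

Set Implicit Arguments.
Unset Strict Implicit.
Unset Printing Implicit Defensive.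
Import Order.TTheory GRing.Theory Num.Theory.
Import numFieldNormedType.Exports.

Local Open Scope classical_set_scope.
Local Open Scope ring_scope.

(* The library norm on ['rV[R]_d] is the sup norm. *)
Definition enorm (R : realType) (d : nat) (x : 'rV[R]_d) : R :=
  Num.sqrt (\sum_(i < d) x ord0 i ^+ 2).

Definition eball (R : realType) (d : nat) (r : R) : set 'rV[R]_d :=
  [set x | enorm x <= r].

Definition gradient (R : realType) (d : nat) (f : 'rV[R]_d -> R)
    (x : 'rV[R]_d) : 'rV[R]_d :=
  \row_(i < d) 'D_(delta_mx ord0 i) f x.

Definition minimizer (R : realType) (d : nat) (f : 'rV[R]_d -> R) :
    set 'rV[R]_d :=
  [set x | forall y, f x <= f y].

Definition smooth_class (R : realType) (d : nat) (r beta : R) :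
    set ('rV[R]_d -> R) :=
  [set f | [/\ convex_function [set: convex_lmodType 'rV[R]_d] f,
               (forall x, differentiable f x) /\ continuous (gradient f),
               forall x y, enorm (gradient f x - gradient f y)
                             <= beta * enorm (x - y) &
               exists xstar, unique (minimizer f) xstar
                             /\ eball (r / 2) xstar]].

(* On [smooth_class] the infimum is attained, so this is the minimum of f. *)
Definition fstar (R : realType) (d : nat) (f : 'rV[R]_d -> R) : R :=
  inf (range f).

(* R^d with its Borel sigma-algebra, the topology being the usual one. *)
Definition borel_space (R : realType) (d : nat) : measurableType _ :=
  g_sigma_algebraType (@open 'rV[R]_d).

Definition observation (R : realType) (d : nat) : measurableType _ :=
  (borel_space R d * measurableTypeR R)%type.

(* The product sigma-algebra on [t.-tuple (observation R d)] is the Borel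
   sigma-algebra of (R^d x R)^t, all factors being second countable. *)
Definition histories (R : realType) (d : nat) (r : R) (t : nat) :
    set (t.-tuple (observation R d)) :=
  [set h | forall i : 'I_t, eball r (tnth h i).1].
Arguments histories {R} d r t.

(* A Borel map (X x R)^t -> X, where X = [eball r], is represented by a total
   map that is measurable on [histories d r t] and sends this set into X; its
   values elsewhere are irrelevant.  Queries are numbered from 0: [query t] is
   the map Q_(t+1), and only the indices t < T are meaningful. *)
Record algorithm (R : realType) (d : nat) (r : R) (T : nat) := Algorithm {
  query : forall t : nat, t.-tuple (observation R d) -> borel_space R d;
  terminal : T.-tuple (observation R d) -> borel_space R d;
  query_measurable : forall t, (t < T)%N ->
    measurable_fun (histories d r t) (@query t);
  query_ball : forall t, (t < T)%N ->
    forall h, histories d r t h -> eball r (query h);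
  terminal_measurable : measurable_fun (histories d r T) terminal;
  terminal_ball : forall h, histories d r T h -> eball r (terminal h) }.
Arguments algorithm {R} d r T.

Fixpoint transcript (R : realType) (d : nat) (r : R) (T : nat)
    (A : algorithm d r T) (f : 'rV[R]_d -> R) (t : nat) :
    t.-tuple (observation R d) :=
  match t with
  | 0%N => [tuple]
  | s.+1 => let h := transcript A f s in
            let x := query A h in [tuple of rcons h (x, f x)]
  end.

Definition oracle_call (R : realType) (d : nat) (r : R) (T : nat)
    (A : algorithm d r T) (f : 'rV[R]_d -> R) (t : nat) : 'rV[R]_d :=
  query A (transcript A f t).

Definition output (R : realType) (d : nat) (r : R) (T : nat)
    (A : algorithm d r T) (f : 'rV[R]_d -> R) : 'rV[R]_d :=
  terminal A (transcript A f T).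

Definition worst_case_error (R : realType) (d : nat) (r beta : R) (T : nat)
    (A : algorithm d r T) : \bar R :=
  ereal_sup [set (f (output A f) - fstar f)%:E | f in smooth_class r beta].

Definition complexity (R : realType) (d : nat) (r beta eps : R) : \bar R :=
  ereal_inf [set (T%:R : R)%:E | T in
    [set T : nat | exists A : algorithm d r T,
                     (worst_case_error beta A <= eps%:E)%E]].
Arguments complexity {R} d r beta eps.

(* Main.v *)
Require Import Defs.
From HB Require Import structures.
From mathcomp Require Import all_boot all_order all_algebra.
From mathcomp Require Import all_classical all_reals all_analysis.
From mathcomp Require Import measurable_realfun ring lra.

Set Implicit Arguments.
Unset Strict Implicit.
Unset Printing Implicit Defensive.
Import Order.TTheory GRing.Theory Num.Theory.
Import numFieldNormedType.Exports.

Local Open Scope classical_set_scope.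
Local Open Scope ring_scope.

(** Nesterov's accelerated projected gradient method, in the three-sequence form
    that keeps every point in the ball of radius r/2, is run with gradients
    replaced by forward differences of step h: one iteration costs d+1 values,
    and all queries stay within h <= r/2 of that ball. If D_k is the optimality
    gap of the k-th iterate x_k and z_k is the projected sequence, then
    k(k+2)/4 D_k + beta/2 |z_k - x*|^2 increases at step k by at most (k+2)/2
    times the error of the difference quotients. Since |x*| <= r/2, the gap
    after N iterations is at most beta r^2 / (2 N^2) + d beta h r; the first term
    is at most eps/8 when N >= 2 sqrt(beta r^2 / eps), and the choice
    h = eps / (4 d beta r) makes the second one eps/4. *)

(** * Euclidean inner product, norm, and projection onto a centred ball *)

Section euclidean.
Context {R : realType} {d : nat}.
Implicit Types (u v w x y z : 'rV[R]_d) (a rho : R).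

Definition dot u v : R := \sum_(i < d) u ord0 i * v ord0 i.

Lemma dotC u v : dot u v = dot v u.
Proof. by apply: eq_bigr => i _; rewrite mulrC. Qed.

Lemma dotDl u v w : dot (u + v) w = dot u w + dot v w.
Proof. by rewrite /dot -big_split; apply: eq_bigr => i _; rewrite mxE mulrDl. Qed.

Lemma dotZl a u v : dot (a *: u) v = a * dot u v.
Proof. by rewrite /dot mulr_sumr; apply: eq_bigr => i _; rewrite mxE mulrA. Qed.

Lemma dot0l v : dot 0 v = 0.
Proof. by rewrite -(scale0r (0 : 'rV[R]_d)) dotZl mul0r. Qed.

Lemma dotNl u v : dot (- u) v = - dot u v.
Proof. by rewrite -scaleN1r dotZl mulN1r. Qed.

Lemma dotDr u v w : dot u (v + w) = dot u v + dot u w.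
Proof. by rewrite dotC dotDl !(dotC u). Qed.

Lemma dotZr a u v : dot u (a *: v) = a * dot u v.
Proof. by rewrite dotC dotZl dotC. Qed.

Lemma dotNr u v : dot u (- v) = - dot u v.
Proof. by rewrite dotC dotNl dotC. Qed.

Definition dotE := (dotDl, dotDr, dotNl, dotNr, dotZl, dotZr).

Lemma dot_ge0 u : 0 <= dot u u.
Proof. by apply: sumr_ge0 => i _; rewrite -expr2 sqr_ge0. Qed.

Lemma enormE u : enorm u = Num.sqrt (dot u u).
Proof. by congr Num.sqrt; apply: eq_bigr => i _; rewrite expr2. Qed.

Lemma enorm_ge0 u : 0 <= enorm u.
Proof. exact: sqrtr_ge0. Qed.

Lemma sqr_enorm u : enorm u ^+ 2 = dot u u.
Proof. by rewrite enormE sqr_sqrtr ?dot_ge0. Qed.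

Lemma enormZ a u : enorm (a *: u) = `|a| * enorm u.
Proof.
by rewrite !enormE !dotE mulrA -expr2 sqrtrM ?sqr_ge0// sqrtr_sqr.
Qed.

Lemma enormN u : enorm (- u) = enorm u.
Proof. by rewrite -scaleN1r enormZ normrN1 mul1r. Qed.

Lemma enorm0 : enorm (0 : 'rV[R]_d) = 0.
Proof. by rewrite -(scale0r (0 : 'rV[R]_d)) enormZ normr0 mul0r. Qed.

Lemma le_coord_enorm u i : `|u ord0 i| <= enorm u.
Proof.
rewrite -sqrtr_sqr ler_wsqrtr// (bigD1 i)//= lerDl.
by apply: sumr_ge0 => j _; exact: sqr_ge0.
Qed.

(** Cauchy-Schwarz: expand the square of [enorm v *: u - enorm u *: v] and divide by the product of
    the norms. A vector of norm zero has zero coordinates, which settles the degenerate cases. *)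
Lemma dot_le_enorm u v : dot u v <= enorm u * enorm v.
Proof.
have [u0|u0] := eqVneq (enorm u) 0.
  suff -> : dot u v = 0 by rewrite u0 mul0r.
  rewrite /dot big1// => i _; have := le_coord_enorm u i.
  by rewrite u0 normr_le0 => /eqP ->; rewrite mul0r.
have ugt0 : 0 < enorm u by rewrite lt_def u0 enorm_ge0.
have [v0|v0] := eqVneq (enorm v) 0.
  suff -> : dot u v = 0 by rewrite v0 mulr0.
  rewrite /dot big1// => i _; have := le_coord_enorm v i.
  by rewrite v0 normr_le0 => /eqP ->; rewrite mulr0.
have vgt0 : 0 < enorm v by rewrite lt_def v0 enorm_ge0.
have := dot_ge0 (enorm v *: u - enorm u *: v).
rewrite !dotE (dotC v u) -!sqr_enorm.
set a := enorm u in ugt0 *; set b := enorm v in vgt0 *; set c := dot u v => H.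
rewrite -(ler_pM2l (mulr_gt0 ugt0 vgt0)).
by lra.
Qed.

Lemma ler_enormD u v : enorm (u + v) <= enorm u + enorm v.
Proof.
rewrite -(ler_pXn2r (n := 2))// ?nnegrE ?addr_ge0 ?enorm_ge0//.
have := dot_le_enorm u v.
rewrite sqr_enorm sqrrD !dotE (dotC v u) !sqr_enorm; lra.
Qed.

Lemma ler_enormB u v : enorm (u - v) <= enorm u + enorm v.
Proof.
by apply: le_trans (ler_enormD _ _) _; rewrite enormN.
Qed.

Lemma eball_convex rho a u v : 0 <= a -> a <= 1 ->
  eball rho u -> eball rho v -> eball rho ((1 - a) *: u + a *: v).
Proof.
rewrite /eball /= => a0 a1 hu hv; apply: le_trans (ler_enormD _ _) _.
have b0 : 0 <= 1 - a by rewrite subr_ge0.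
rewrite !enormZ !ger0_norm//.
have := ler_wpM2l b0 hu; have := ler_wpM2l a0 hv; lra.
Qed.

(** For [rho > 0] this is the nearest point of the ball of radius [rho]. The maximum replaces a case
    distinction, so measurability follows from that of the norm. *)
Definition eproj rho w : 'rV[R]_d := (rho / Num.max rho (enorm w)) *: w.

Lemma eball_eproj rho w : 0 < rho -> eball rho (eproj rho w).
Proof.
move=> rho0; rewrite /eball /eproj /= enormZ.
have m0 : 0 < Num.max rho (enorm w) by rewrite lt_max rho0.
have q0 : 0 <= rho / Num.max rho (enorm w) by rewrite divr_ge0 ?ltW.
rewrite ger0_norm// mulrAC ler_pdivrMr//.
by rewrite ler_pM2l// le_max lexx orbT.
Qed.

(** Outside the ball, with [t = rho / enorm w], the product factors as
    [(1 - t) * (rho * enorm w - dot w u)], and both factors are nonnegative, the second by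
    Cauchy-Schwarz. *)
Lemma eproj_variational rho w u : 0 < rho -> eball rho u ->
  0 <= dot (eproj rho w - w) (u - eproj rho w).
Proof.
rewrite /eball /= => rho0 hu; have := enorm_ge0 w; have := dot_le_enorm w u.
have := sqr_enorm w.
rewrite /eproj; case: (leP (enorm w) rho) => hw.
  rewrite divff ?gt_eqF// scale1r subrr => _ _ _.
  by rewrite dot0l.
set b := enorm w in hw *.
have b0 : 0 < b by exact: lt_trans hw.
rewrite !dotE => <- hd _.
pose t := rho / b; rewrite -/t.
have t1 : rho / b <= 1 by rewrite ler_pdivrMr// mul1r ltW.
rewrite -/t in t1.
have tb : t * b = rho by rewrite /t divfK ?gt_eqF.
have -> : t * dot w u - t * (t * b ^+ 2) + (- dot w u - - (t * b ^+ 2))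
  = (1 - t) * (t * b * b - dot w u) by ring.
rewrite tb mulr_ge0 ?subr_ge0//; apply: le_trans hd _.
by rewrite mulrC ler_wpM2r// ltW.
Qed.

(* Expanding [|u - z|^2] around the new point turns the variational inequality
   of the projection into a telescoping bound. *)
Lemma eproj_step rho c g z z' u : 0 < rho -> 0 < c -> eball rho u ->
  z' = eproj rho (z - c^-1 *: g) ->
  dot g (z' - u) + c / 2 * dot (z' - z) (z' - z) <=
  c / 2 * (dot (u - z) (u - z) - dot (u - z') (u - z')).
Proof.
move=> rho0 c0 hu z'E.
have := eproj_variational (z - c^-1 *: g) rho0 hu; rewrite -z'E.
rewrite -(pmulr_rge0 _ c0) => H; rewrite -subr_ge0; apply: le_trans H _.
rewrite !dotE (dotC z z') (dotC u z') (dotC u z).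
rewrite le_eqVlt; apply/orP; left; apply/eqP; field.
by rewrite gt_eqF.
Qed.

End euclidean.

(** * Directional derivatives and the quadratic upper bound *)

Section smooth.
Context {R : realType} {d : nat}.
Implicit Types (f : 'rV[R]_d -> R) (u v x y : 'rV[R]_d).

Lemma derive_gradient f x v : differentiable f x ->
  'D_v f x = dot (gradient f x) v.
Proof.
move=> df; rewrite deriveE// [in LHS](row_sum_delta v) linear_sum.
by apply: eq_bigr => i _; rewrite linearZ /= mxE deriveE// mulrC.
Qed.

Lemma is_derive_line f y v (t : R) : differentiable f (y + t *: v) ->
  is_derive t 1 (fun s : R => f (y + s *: v)) (dot (gradient f (y + t *: v)) v).
Proof.
move=> df; rewrite -derive_gradient//.
have E : (fun h : R => h^-1 *: (((fun s : R => f (y + s *: v)) \o shift t) (h *: 1)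
            - f (y + t *: v)))
       = (fun h : R => h^-1 *: ((f \o shift (y + t *: v)) (h *: v) - f (y + t *: v))).
  apply/funext => h /=; congr (_ *: (f _ - _)).
  by rewrite [h%:A]mulr1 scalerDl addrCA.
split; last by rewrite /derive E.
by rewrite /derivable E; exact: diff_derivable.
Qed.

Lemma taylor_lipschitz f (beta : R) y v :
  (forall x, differentiable f x) ->
  (forall x z, enorm (gradient f x - gradient f z) <= beta * enorm (x - z)) ->
  f (y + v) <= f y + dot (gradient f y) v + beta / 2 * dot v v.
Proof.
move=> df lip.
pose a := dot (gradient f y) v; pose b := beta / 2 * dot v v.
pose psi (t : R) := f (y + t *: v) - (t * a + t ^+ 2 * b).
pose dpsi (t : R) := dot (gradient f (y + t *: v)) v - (a + 2 * t * b).
have dpsiP (t : R) : is_derive t 1 psi (dpsi t).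
  apply: is_deriveB; first exact: is_derive_line.
  have -> : (fun s : R => s * a + s ^+ 2 * b) =
     (fun s => a *: s + b *: s ^+ 2).
    by apply/funext => s; rewrite /GRing.scale /= mulrC (mulrC b).
  apply: is_derive_eq.
  by rewrite /GRing.scale /= ; ring.
have cpsi : {within `[0, 1], continuous psi}.
  apply: continuous_subspaceT => t.
  by apply: differentiable_continuous; apply/derivable1_diffP.
have [c cI E] := MVT ltr01 (fun t _ => dpsiP t) cpsi.
have c0 : 0 <= c by move: cI; rewrite in_itv /= => /andP[/ltW].
have : dpsi c <= 0.
  have := le_trans (dot_le_enorm _ v)
     (ler_wpM2r (enorm_ge0 v) (lip (y + c *: v) y)).
  rewrite (addrC y) addrK enormZ ger0_norm// dotDl dotNl.
  rewrite /dpsi /b /a -sqr_enorm (addrC y).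
  by lra.
move: E; rewrite subr0 mulr1 => <-.
by rewrite /psi /b /a scale0r scale1r addr0; lra.
Qed.

End smooth.

(** * First-order inequalities on the objective class and one accelerated step *)

Section smooth_class.
Context {R : realType} {d : nat} (r beta : R) (f : 'rV[R]_d -> R).
Implicit Types (u v x y : 'rV[R]_d).
Hypotheses (beta_gt0 : 0 < beta) (fS : smooth_class r beta f).

Lemma smooth_class_upper y v :
  f (y + v) <= f y + dot (gradient f y) v + beta / 2 * dot v v.
Proof. by case: fS => _ [df _] lip _; exact: taylor_lipschitz. Qed.

Lemma smooth_class_convex y v (t : R) : 0 <= t -> t <= 1 ->
  f (y + t *: v) <= (1 - t) * f y + t * f (y + v).
Proof.
move=> t0 t1; case: fS => cf _ _ _.
have H : f (t *: (y + v) + (1 - t) *: y) <= t * f (y + v) + (1 - t) * f y.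
  by apply: (cf (Itv01 t0 t1)); rewrite in_setT.
rewrite [leRHS]addrC; apply: le_trans H; rewrite le_eqVlt; apply/orP; left; apply/eqP.
congr f; rewrite scalerDr scalerBl scale1r addrAC.
by rewrite [t *: y + _]addrCA subrr addr0.
Qed.

(* A quadratic lower bound with any constant suffices: convexity along the
   segment, divided by its length [t], turns the bound into the linear one as
   [t] tends to 0. *)
Lemma smooth_class_lower y v : f y + dot (gradient f y) v <= f (y + v).
Proof.
have low w : f y + dot (gradient f y) w - 3 / 2 * beta * dot w w <= f (y + w).
  (* The upper bound taken backwards from [y + w] costs [beta / 2]; moving its gradient from [y + w]
     to [y] costs another [beta], whence the constant 3/2. *)
  have := smooth_class_upper (y + w) (- w); rewrite addrK !dotE.
  have lip : enorm (gradient f (y + w) - gradient f y) <= beta * enorm w.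
    by case: fS => _ _ /(_ (y + w) y) + _; rewrite [y + w - y]addrC addKr.
  have := dot_le_enorm (gradient f y - gradient f (y + w)) w.
  rewrite -opprB enormN.
  have := ler_wpM2r (enorm_ge0 w) lip.
  by rewrite -[leRHS]mulrA -expr2 sqr_enorm !dotE; lra.
rewrite leNgt; apply/negP => lt.
pose m := f y + dot (gradient f y) v - f (y + v).
have m0 : 0 < m by rewrite subr_gt0.
pose K := 3 / 2 * beta * dot v v.
have K0 : 0 <= K by rewrite !mulr_ge0 ?dot_ge0 ?ltW.
have mK : 0 < m + K by lra.
(* Convexity and [low] will give [m <= t * K], whereas this [t] satisfies
   [m - t * K = t * m > 0]. *)
pose t := m / (m + K).
have t0 : 0 < t by rewrite /t divr_gt0.
have t1 : t <= 1 by rewrite /t ler_pdivrMr// mul1r; lra.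
have := le_trans (low (t *: v)) (smooth_class_convex y v (ltW t0) t1).
rewrite !dotE => H.
have {}H : t * m <= t * (t * K) by rewrite /m /K; lra.
move: H; rewrite ler_pM2l// => H.
have tmK : t * (m + K) = m by rewrite /t divfK ?gt_eqF.
have := mulr_gt0 t0 m0; lra.
Qed.

(** The linear lower bound and the quadratic upper bound place the Taylor remainder at step [h]
    between 0 and [beta * h ^+ 2 / 2]; dividing by [h] gives the error. *)
Lemma finite_difference_error y (h : R) i : 0 < h ->
  `|gradient f y ord0 i
    - h^-1 * (f (y + h *: delta_mx ord0 i) - f y)| <= beta * h / 2.
Proof.
move=> h0.
have dotd u : dot u (delta_mx ord0 i) = u ord0 i.
  rewrite /dot (bigD1 i)//= mxE !eqxx mulr1 big1 ?addr0// => j ji.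
  by rewrite mxE eqxx (negbTE ji) mulr0.
have := smooth_class_upper y (h *: delta_mx ord0 i).
have := smooth_class_lower y (h *: delta_mx ord0 i).
have d1 : (delta_mx ord0 i : 'rV[R]_d) ord0 i = 1 by rewrite mxE !eqxx.
rewrite !dotE !dotd d1 mulr1.
set a := gradient _ _ _ _; set F := f (y + _) => H1 H2.
have -> : a - h^-1 * (F - f y) = - (h^-1 * (F - f y - h * a)).
  by field; rewrite gt_eqF.
have H3 : 0 <= F - f y - h * a by lra.
rewrite normrN ger0_norm; last by rewrite mulr_ge0// invr_ge0 ltW.
by rewrite mulrC ler_pdivrMr//; lra.
Qed.

Lemma smooth_class_minimizer : exists2 u, eball (r / 2) u &
  (forall x, f u <= f x) /\ fstar f = f u.
Proof.
case: fS => _ _ _ [u [[umin _] ub]]; exists u => //; split=> //.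
apply/eqP; rewrite eq_le; apply/andP; split.
  by apply: ge_inf; [exists (f u) => _ [x _ <-]; exact: umin|exists u].
by apply: lb_le_inf; [exists (f u), u|move=> _ [x _ <-]; exact: umin].
Qed.

(** Combine the upper bound at [y] with the linear lower bounds towards [x] and [u], weighted by
    [1 - theta] and [theta]. The projection inequality with [c = theta * beta], multiplied by
    [theta], cancels the quadratic term in [z' - z]; [e] pays for using [g] instead of the
    gradient. *)
Lemma accelerated_step x y z z' g u rho theta e :
  0 < rho -> 0 < theta -> theta <= 1 -> eball rho u ->
  y = (1 - theta) *: x + theta *: z ->
  z' = eproj rho (z - (theta * beta)^-1 *: g) ->
  dot (gradient f y - g) (z' - u) <= e ->
  f ((1 - theta) *: x + theta *: z') <=
  (1 - theta) * f x + theta * f u + theta * e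
  + theta ^+ 2 * beta / 2 * (dot (u - z) (u - z) - dot (u - z') (u - z')).
Proof.
move=> rho0 th0 th1 ub yE z'E ge.
have up := smooth_class_upper y (theta *: (z' - z)).
have lowx := smooth_class_lower y (x - y).
have lowu := smooth_class_lower y (u - y).
have pr := eproj_step rho0 (mulr_gt0 th0 beta_gt0) ub z'E.
rewrite (addrC y) subrK in lowx; rewrite (addrC y) subrK in lowu.
have x'E : y + theta *: (z' - z) = (1 - theta) *: x + theta *: z'.
  by rewrite yE scalerBr -addrA; congr (_ + _); rewrite addrC subrK.
rewrite x'E in up; apply: le_trans up _.
have dotyE w : dot w y = (1 - theta) * dot w x + theta * dot w z.
  by rewrite yE dotDr !dotZr.
have {dotyE} := dotyE (gradient f y).
have th1' : 0 <= 1 - theta by rewrite subr_ge0.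
have {}lowx := ler_wpM2l th1' lowx.
have {}lowu := ler_wpM2l (ltW th0) lowu.
have {}pr := ler_wpM2l (ltW th0) pr.
have {}ge := ler_wpM2l (ltW th0) ge.
move=> dotyE; move: dotyE lowx lowu pr ge.
rewrite dotZr dotZl dotZr.
set D' := dot (u - z') _; set D := dot (u - z) _; set Q := dot (z' - z) _.
rewrite !dotE.
set gy := dot _ y; set gx := dot _ x; set gz := dot _ z; set gz' := dot _ z'.
set gu := dot _ u; set hz' := dot _ z'; set hu := dot _ u.
move=> dotyE lowx lowu pr ge.
(* The relation for [gy] is multiplied by both weights beforehand, since [lra] does not find
   products of hypotheses with variables. *)
have : theta * gy = theta * ((1 - theta) * gx + theta * gz) by rewrite dotyE.
have : (1 - theta) * gy = (1 - theta) * ((1 - theta) * gx + theta * gz)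
  by rewrite dotyE.
lra.
Qed.

End smooth_class.

(** * Borel measurability of maps into R^d, through coordinates *)

Section measurability.
Context {d' : measure_display} {T : measurableType d'} {R : realType} {d : nat}.
Implicit Types (g : T -> 'rV[R]_d).

Definition coord_measurable g :=
  forall i, measurable_fun [set: T] (fun t => g t ord0 i).

Lemma ball_rowP (x y : 'rV[R]_d) (e : R) : 0 < e ->
  ball x e y <-> forall i, ball (x ord0 i) e (y ord0 i).
Proof.
move=> e0; split; first by case=> _ h i; exact: h.
by move=> h; split=> // i j; rewrite (ord1 i).
Qed.

(* Open sets of R^d are countable unions of sup-norm balls with rational
   centres, so the Borel sets of R^d are generated by the coordinates. *)
Lemma measurable_row g : coord_measurable g ->
  measurable_fun [set: T] (g : T -> borel_space R d).
Proof.
move=> mg; apply: (@measurability _ _ T (borel_space R d) setT g (@open 'rV[R]_d)) => // _ [U oU <-].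
rewrite setTI.
pose c (p : 'rV[rat]_d * nat) : 'rV[R]_d := map_mx ratr p.1.
pose e (p : 'rV[rat]_d * nat) : R := p.2.+1%:R^-1.
have e0 p : 0 < e p by rewrite invr_gt0.
pose F p : set T := if `[< ball (c p) (e p) `<=` U >]
  then \bigcap_(i : 'I_d) [set t | ball (c p ord0 i) (e p) (g t ord0 i)]
  else set0.
have -> : g @^-1` U = \bigcup_p F p.
  apply/seteqP; split => [t Ut|t [p _]]; last first.
    rewrite /F; case: asboolP => // pU Ft; apply: pU.
    by apply/ball_rowP => // i; exact: Ft.
  have /nbhs_ballP[r r0 rU] : nbhs (g t) U by apply: open_nbhs_nbhs.
  (* The radius [s] is at most [r / 2]: a ball of radius [s] containing [g t] then stays inside the
     ball of radius [r] around [g t]. *)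
  pose n := Num.truncn (2 / r); pose s : R := n.+1%:R^-1.
  have s0 : 0 < s by rewrite invr_gt0.
  have s2r : s + s <= r.
    have : 2 / r < n.+1%:R by exact: Num.Theory.truncnS_gt.
    rewrite ltr_pdivrMr// => /ltW.
    rewrite -[_ <= r](ler_pM2l (ltr0Sn R n)) mulrDr mulfV ?pnatr_eq0//.
  have q_ i : exists q : rat, `|ratr q - g t ord0 i| < s.
    have lt : g t ord0 i - s < g t ord0 i + s by lra.
    have [q] := rat_in_itvoo lt; rewrite in_itv /= => /andP[q1 q2].
    by exists q; rewrite ltr_norml; apply/andP; split; lra.
  have [q qP] := choice q_.
  have tq : ball (\row_i ratr (q i) : 'rV[R]_d) s (g t).
    by apply/ball_rowP => // i; rewrite mxE; exact: qP.
  have cE : c (\row_i q i, n) = \row_i ratr (q i).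
    by apply/rowP => i; rewrite !mxE.
  exists (\row_i q i, n) => //; rewrite /F asboolT.
    by move=> i _ /=; rewrite cE; move: i; apply/ball_rowP.
  rewrite cE => x /(ball_triangle (ball_sym tq)) /(le_ball s2r); exact: rU.
apply: countable_bigcupT_measurable => // p; rewrite /F.
case: ifP => // _; apply: fin_bigcap_measurable => // i _.
have := mg i measurableT _ (measurable_ball (c p ord0 i) (e p)).
by rewrite setTI.
Qed.

Lemma coord_measurableD g1 g2 : coord_measurable g1 -> coord_measurable g2 ->
  coord_measurable (fun t => g1 t + g2 t).
Proof.
move=> m1 m2 i; under eq_fun do rewrite mxE.
exact: measurable_funD.
Qed.

Lemma coord_measurableZ (a : T -> R) g : measurable_fun [set: T] a ->
  coord_measurable g -> coord_measurable (fun t => a t *: g t).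
Proof.
move=> ma mg i; under eq_fun do rewrite mxE.
exact: measurable_funM.
Qed.

Lemma measurable_enorm g : coord_measurable g ->
  measurable_fun [set: T] (fun t => enorm (g t)).
Proof.
move=> mg; apply: measurableT_comp.
  by apply: continuous_measurable_fun; exact: sqrt_continuous.
by apply: measurable_sum => i; exact: measurable_funX.
Qed.

Lemma coord_measurable_eproj (rho : R) g : 0 < rho -> coord_measurable g ->
  coord_measurable (fun t => eproj rho (g t)).
Proof.
move=> rho0 mg; apply: coord_measurableZ => //.
apply: measurable_funM; first exact: measurable_cst.
apply: (measurableT_comp (f := fun s : R => (Num.max rho s)^-1));
  last exact: measurable_enorm.
apply: continuous_measurable_fun => s.
apply: (@cvgV _ _ _ _ (fun s : R => Num.max rho s)).
  by rewrite gt_eqF// lt_max rho0.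
by apply: (@continuous_max _ R (fun=> rho) id s) => //; exact: cst_continuous.
Qed.

End measurability.

(** * The iteration as a function of the sequence of observed values *)

Section accelerated_iteration.
Context {R : realType} (d : nat) (rho beta h : R).
Implicit Types (v : nat -> R) (k : nat).

(** With theta = 2/(k+2), the quotient (1 - theta)/theta^2 equals k(k+2)/4, the coefficient of the
    gap in the potential. *)
Definition weight k : R := 2 / k.+2%:R.

(** The same combination serves twice: with the old [z] it is the point where the gradient is
    estimated, with the new [z] it is the next [x]. *)
Definition midpoint k (s : 'rV[R]_d * 'rV[R]_d) : 'rV[R]_d :=
  (1 - weight k) *: s.1 + weight k *: s.2.

(* The k-th block of d+1 observations holds the values of f at y + h e_j for
   j < d, followed by the value at y itself. *)
Definition difference_quotients v k : 'rV[R]_d :=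
  \row_(i < d) (h^-1 * (v (k * d.+1 + i)%N - v (k * d.+1 + d)%N)).

Definition next v k (s : 'rV[R]_d * 'rV[R]_d) : 'rV[R]_d * 'rV[R]_d :=
  let z := eproj rho
    (s.2 - (weight k * beta)^-1 *: difference_quotients v k) in
  (midpoint k (s.1, z), z).

(** The argument is a bare value sequence, so that one definition serves both the algorithm, which
    reads a finite history, and the analysis, which uses the values of [f]. *)
Fixpoint iterate v k : 'rV[R]_d * 'rV[R]_d :=
  if k is k'.+1 then next v k' (iterate v k') else (0, 0).

(** Indexing by a natural number lets [j = d] give the zero vector, which is the last query of a
    block. *)
Definition offset (j : nat) : 'rV[R]_d := \row_(i < d) (h *+ (i == j :> nat)).

Definition probe v (t : nat) : 'rV[R]_d :=
  midpoint (t %/ d.+1) (iterate v (t %/ d.+1)) + offset (t %% d.+1).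

Lemma weight_gt0 k : 0 < weight k.
Proof. exact: divr_gt0. Qed.

Lemma weight_le1 k : weight k <= 1.
Proof. by rewrite /weight ler_pdivrMr// mul1r ler_nat. Qed.

Lemma offset_ord (j : 'I_d) : offset j = h *: delta_mx ord0 j.
Proof.
by apply/rowP => i; rewrite !mxE eqxx /= mulr_natr.
Qed.

Lemma offset_last : offset d = 0.
Proof. by apply/rowP => i; rewrite !mxE ltn_eqF. Qed.

Lemma enorm_offset j : (j < d.+1)%N -> 0 < h -> enorm (offset j) <= h.
Proof.
rewrite ltnS leq_eqVlt => /orP[/eqP ->|jd] h0.
  by rewrite offset_last enorm0 ltW.
rewrite (offset_ord (Ordinal jd)) enormZ gtr0_norm//.
suff -> : enorm (delta_mx ord0 (Ordinal jd) : 'rV[R]_d) = 1 by rewrite mulr1.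
rewrite /enorm (bigD1 (Ordinal jd))//= mxE !eqxx big1 => [|i /negbTE ij].
  by rewrite addr0 expr1n sqrtr1.
by rewrite mxE ij andbF expr0n.
Qed.

Lemma eball_midpoint k s :
  eball rho s.1 -> eball rho s.2 -> eball rho (midpoint k s).
Proof. by apply: eball_convex; [exact/ltW/weight_gt0|exact: weight_le1]. Qed.

Lemma eball_iterate v k : 0 < rho ->
  eball rho (iterate v k).1 /\ eball rho (iterate v k).2.
Proof.
move=> rho0; elim: k => [|k [IH1 IH2]] /=.
  by rewrite /eball /= enorm0 ltW.
by split; [apply: eball_midpoint => //|]; exact: eball_eproj.
Qed.

Lemma eball_probe v t : 0 < rho -> 0 < h -> eball (rho + h) (probe v t).
Proof.
move=> rho0 h0; have [H1 H2] := eball_iterate v (t %/ d.+1) rho0.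
apply: le_trans (ler_enormD _ _) (lerD _ _); first exact: eball_midpoint.
by rewrite enorm_offset// ltn_mod.
Qed.

Lemma iterate_ext v v' k : (forall i, (i < k * d.+1)%N -> v i = v' i) ->
  iterate v k = iterate v' k.
Proof.
elim: k => //= k IH H; rewrite /next IH => [|i ik]; last first.
  by apply: H; rewrite mulSn ltn_addl.
suff -> : difference_quotients v k = difference_quotients v' k by [].
apply/rowP => i; rewrite !mxE !H//.
  by rewrite mulSn addnC ltn_add2r.
by rewrite mulSn addnC ltn_add2r leqW.
Qed.

(** Query [t] reads only completed blocks, whose indices lie below [t %/ d.+1 * d.+1 <= t]. Hence it
    can be computed from the history. *)
Lemma probe_ext v v' t : (forall i, (i < t)%N -> v i = v' i) ->
  probe v t = probe v' t.
Proof.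
move=> H; rewrite /probe (@iterate_ext v v')// => i it.
by apply: H; apply: leq_trans it _; exact: leq_divM.
Qed.

Lemma probe_block v k j : (j < d.+1)%N ->
  probe v (k * d.+1 + j) = midpoint k (iterate v k) + offset j.
Proof.
by move=> jd; rewrite /probe divnMDl// modnMDl divn_small// modn_small// addn0.
Qed.

Lemma coord_measurable_iterate d' (T : measurableType d') (v : T -> nat -> R) k :
  0 < rho -> (forall i, measurable_fun [set: T] (fun t => v t i)) ->
  coord_measurable (fun t => (iterate (v t) k).1) /\
  coord_measurable (fun t => (iterate (v t) k).2).
Proof.
move=> rho0 mv; elim: k => [|k [IH1 IH2]] /=.
  by split=> i; exact: measurable_cst.
have mz : coord_measurable (fun t => (next (v t) k (iterate (v t) k)).2).
  apply: coord_measurable_eproj => //; apply: coord_measurableD => //.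
  under eq_fun do rewrite -scaleNr.
  apply: coord_measurableZ; first exact: measurable_cst.
  move=> i; under eq_fun do rewrite mxE.
  apply: measurable_funM; first exact: measurable_cst.
  exact: measurable_funB.
split=> //; apply: coord_measurableD; apply: coord_measurableZ => //;
  exact: measurable_cst.
Qed.

Lemma measurable_probe d' (T : measurableType d') (v : T -> nat -> R) t :
  0 < rho -> (forall i, measurable_fun [set: T] (fun s => v s i)) ->
  measurable_fun [set: T] ((fun s => probe (v s) t) : T -> borel_space R d).
Proof.
move=> rho0 mv; apply: measurable_row.
have [m1 m2] := coord_measurable_iterate (t %/ d.+1) rho0 mv.
apply: coord_measurableD; last by move=> i; exact: measurable_cst.
by apply: coord_measurableD; apply: coord_measurableZ => //;
  exact: measurable_cst.
Qed.

End accelerated_iteration.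

(** * Convergence rate with inexact gradients *)

Section convergence.
Context {R : realType} {d : nat} (r beta h : R) (f : 'rV[R]_d -> R).
Variables (v : nat -> R) (u : 'rV[R]_d).
Hypotheses (r_gt0 : 0 < r) (beta_gt0 : 0 < beta) (h_gt0 : 0 < h).
Hypotheses (fS : smooth_class r beta f).
Hypotheses (vE : forall t, v t = f (probe d (r / 2) beta h v t)).
Hypotheses (ub : eball (r / 2) u) (umin : forall x, f u <= f x).

Let rho_gt0 : 0 < r / 2. Proof. exact: divr_gt0. Qed.

Local Notation it k := (iterate d (r / 2) beta h v k).
Local Notation err := (d%:R * (beta * h / 2) * r).

(** By [vE] the recorded values are those of [f] at the probes, so each coordinate is off by at most
    [beta * h / 2]; summing over [d] coordinates, each of [w] at most [r] in absolute value, gives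
    [err]. *)
Lemma gradient_error k w : enorm w <= r ->
  dot (gradient f (midpoint k (it k)) - difference_quotients d h v k) w <= err.
Proof.
move=> wr; rewrite -mulrA [d%:R * _]mulr_natl -[in leRHS](card_ord d) -sumr_const.
apply: ler_sum => i _; apply: le_trans (ler_norm _) _; rewrite normrM.
apply: ler_pM => //; last exact: le_trans (le_coord_enorm w i) wr.
rewrite !mxE !vE !probe_block// ?leqW// offset_ord offset_last addr0.
by have := finite_difference_error beta_gt0 fS (midpoint k (it k)) i h_gt0;
  rewrite mxE.
Qed.

(** The coefficient k(k+3)/4 of the error is the sum of (j+2)/2 over j < k. *)
Lemma iterate_rate k :
  k%:R * (k%:R + 2) / 4 * (f (it k).1 - f u)
    + beta / 2 * dot (u - (it k).2) (u - (it k).2)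
  <= beta / 2 * dot u u + k%:R * (k%:R + 3) / 4 * err.
Proof.
elim: k => [|k IH]; first by rewrite /= subr0 !mul0r add0r addr0.
have [H1 H2] := eball_iterate d beta h v k rho_gt0.
have [H1' H2'] := eball_iterate d beta h v k.+1 rho_gt0.
have wr : enorm ((it k.+1).2 - u) <= r.
  by apply: le_trans (ler_enormB _ _) _; rewrite [leRHS]splitr; exact: lerD.
have step : f (it k.+1).1 <= (1 - weight k) * f (it k).1 + weight k * f u
    + weight k * err + weight k ^+ 2 * beta / 2
      * (dot (u - (it k).2) (u - (it k).2)
         - dot (u - (it k.+1).2) (u - (it k.+1).2)).
  exact: (accelerated_step beta_gt0 fS rho_gt0 (weight_gt0 k) (weight_le1 k)
    ub (erefl _) (erefl _) (gradient_error k wr)).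
have := umin (it k.+1).1; move: step IH.
set F' := f (it k.+1).1; set F := f (it k).1; set D := dot (u - (it k).2) _.
set D' := dot (u - (it k.+1).2) _; set e := err.
rewrite -[k.+1%:R]natr1; set n : R := k%:R.
have n0 : 0 <= n by exact: ler0n.
have -> : weight k = 2 / (n + 2) by rewrite /weight -(addn2 k) natrD.
move=> step IH F'0.
have n2 : n + 2 != 0 by rewrite gt_eqF//; lra.
have q0 : 0 <= (n + 2) ^+ 2 / 4 by rewrite divr_ge0 ?sqr_ge0.
(* Multiplying by the inverse square of the weight leaves (k+2)^2/4 on the new gap. This exceeds
   (k+1)(k+3)/4 by 1/4, and the excess is dropped because [u] is a minimizer. *)
have := ler_wpM2l q0 step.
have -> : (n + 2) ^+ 2 / 4 * ((1 - 2 / (n + 2)) * F + 2 / (n + 2) * f u +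
  2 / (n + 2) * e + (2 / (n + 2)) ^+ 2 * beta / 2 * (D - D')) =
  n * (n + 2) / 4 * F + (n + 2) / 2 * f u + (n + 2) / 2 * e
  + beta / 2 * (D - D') by field.
lra.
Qed.

Lemma iterate_error k : (0 < k)%N ->
  f (it k).1 - f u <= beta * r ^+ 2 / (2 * k%:R ^+ 2) + d%:R * beta * h * r.
Proof.
move=> k0; have := iterate_rate k.
set D := dot (u - _) _; have D0 : 0 <= D by exact: dot_ge0.
have : dot u u <= (r / 2) ^+ 2.
  by rewrite -sqr_enorm ler_pXn2r// nnegrE ?enorm_ge0// ltW.
have := umin (it k).1; set F := f (it k).1.
set n : R := k%:R; have n1 : 1 <= n by rewrite ler1n.
have e0 : 0 <= err by rewrite !mulr_ge0// ltW.
set e := err in e0 * => F0 uu H.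
have -> : d%:R * beta * h * r = 2 * e by rewrite /e; field.
have nn : 0 < n * (n + 2) / 4 by rewrite divr_gt0// mulr_gt0//; lra.
have bD : 0 <= beta / 2 * D by rewrite mulr_ge0// ltW// divr_gt0.
have b2 : 0 <= beta / 2 by rewrite ltW// divr_gt0.
have bu := ler_wpM2l b2 uu.
rewrite -(ler_pM2l nn).
(* Up to the factor 1/4 this is the slack in k(k+3)/4 <= 2 k(k+2)/4, which bounds the accumulated
   error by [2 * e] after division. *)
have ne : 0 <= (n * (n + 1)) * e by apply: mulr_ge0 => //; apply: mulr_ge0; lra.
(* The left side bounds the initial potential, since [u] has norm at most [r / 2]. *)
have A : beta * r ^+ 2 / 8 <= n * (n + 2) / 4 * (beta * r ^+ 2 / (2 * n ^+ 2)).
  have -> : n * (n + 2) / 4 * (beta * r ^+ 2 / (2 * n ^+ 2)) =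
     beta * r ^+ 2 / 8 + beta * r ^+ 2 / 4 / n.
    by field; rewrite gt_eqF//; lra.
  rewrite lerDl; apply: divr_ge0; last by lra.
  by apply: divr_ge0 => //; apply: mulr_ge0; rewrite ?sqr_ge0 ?ltW.
lra.
Qed.

End convergence.

(** * The algorithm and its worst-case error *)

Section zeroth_order_algorithm.
Context {R : realType} {d : nat} (r beta h : R) (N : nat).
Hypotheses (r_gt0 : 0 < r) (h_gt0 : 0 < h) (h_le : h <= r / 2).

(** The default 0 extends a finite history to a full sequence; the extension lemmas show that the
    padding is never read. *)
Definition values t (H : t.-tuple (observation R d)) (i : nat) : R :=
  nth 0 (map (fun o : observation R d => o.2 : R) H) i.

Lemma measurable_values t i : measurable_fun
  [set: t.-tuple (observation R d)] (fun H => values H i).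
Proof.
have [it|ti] := ltnP i t; last first.
  rewrite (_ : (fun _ => _) = cst 0); first exact: measurable_cst.
  by apply/funext => H; rewrite /values nth_default ?size_map ?size_tuple.
rewrite (_ : (fun _ => _) = snd \o (fun H => tnth H (Ordinal it))).
  by apply: measurableT_comp => //; exact: measurable_tnth.
apply/funext => H /=; rewrite /values (nth_map (tnth_default H (Ordinal it))).
  by rewrite /tnth; congr (_.2); apply: set_nth_default; rewrite size_tuple.
by rewrite size_tuple.
Qed.

Let rho_gt0 : 0 < r / 2. Proof. exact: divr_gt0. Qed.

Let query_map (t : nat) (H : t.-tuple (observation R d)) : borel_space R d :=
  probe d (r / 2) beta h (values H) t.

Let terminal_map (H : (d.+1 * N).-tuple (observation R d)) : borel_space R d :=
  (iterate d (r / 2) beta h (values H) N).1.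

Let query_map_measurable t : (t < d.+1 * N)%N ->
  measurable_fun (histories d r t) (@query_map t).
Proof.
move=> _; apply: measurable_funTS; apply: measurable_probe => // i.
exact: measurable_values.
Qed.

Lemma eball_query v t : eball r (probe d (r / 2) beta h v t).
Proof.
have := eball_probe d beta v t rho_gt0 h_gt0; rewrite /eball /= => /le_trans.
by apply; rewrite [leRHS]splitr lerD2l.
Qed.

Let terminal_map_measurable : measurable_fun (histories d r (d.+1 * N)) terminal_map.
Proof.
apply: measurable_funTS; apply: measurable_row.
by apply: (coord_measurable_iterate _ _ _ _ _ _).1 => // i; exact: measurable_values.
Qed.

Let eball_terminal v : eball (r / 2) (iterate d (r / 2) beta h v N).1.
Proof. exact: (eball_iterate _ _ _ _ _ rho_gt0).1. Qed.

Let terminal_map_ball H : histories d r (d.+1 * N) H -> eball r (terminal_map H).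
Proof.
move=> _; have := eball_terminal (values H); rewrite /eball /= => /le_trans.
by apply; rewrite ler_pdivrMr// ler_pMr// ler1n.
Qed.

Definition zeroth_order_algorithm : algorithm d r (d.+1 * N) :=
  @Algorithm R d r (d.+1 * N) query_map terminal_map query_map_measurable
    (fun t _ H _ => eball_query (values H) t)
    terminal_map_measurable terminal_map_ball.

Local Notation A := zeroth_order_algorithm.

Lemma eball_oracle_call f t : eball r (oracle_call A f t).
Proof. exact: eball_query. Qed.

Lemma eball_output f : eball (r / 2) (output A f).
Proof. exact: eball_terminal. Qed.

Lemma values_transcript f t i : (i < t)%N ->
  values (transcript A f t) i = f (oracle_call A f i).
Proof.
elim: t => // t IH; rewrite ltnS leq_eqVlt => /orP[/eqP ->|it].
  by rewrite /values /= map_rcons nth_rcons size_map size_tuple ltnn eqxx.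
rewrite /values /= map_rcons nth_rcons size_map size_tuple it.
exact: IH.
Qed.

Lemma zeroth_order_algorithm_error f :
  0 < beta -> (0 < N)%N -> smooth_class r beta f ->
  f (output A f) - fstar f <=
    beta * r ^+ 2 / (2 * N%:R ^+ 2) + d%:R * beta * h * r.
Proof.
move=> beta_gt0 N_gt0 fS.
have [u ub [umin ->]] := smooth_class_minimizer fS.
(* This sequence also runs past the budget, as [oracle_call] is defined for every index; it agrees
   with each history on the indices recorded there. *)
pose v t := f (oracle_call A f t).
have vE t : v t = f (probe d (r / 2) beta h v t).
  rewrite /v {1}/oracle_call /= /query_map; congr f; apply: probe_ext => i it.
  exact: values_transcript.
have -> : output A f = (iterate d (r / 2) beta h v N).1.
  rewrite /output /= /terminal_map; congr (_.1); apply: iterate_ext => i iN.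
  by apply: values_transcript; rewrite mulnC.
exact: iterate_error.
Qed.

End zeroth_order_algorithm.

(** * Choice of the parameters and the complexity bounds *)

Theorem theorem3p3 (R : realType) (d : nat) (r beta eps : R)
    (d_gt0 : (0 < d)%N) (r_gt0 : 0 < r) (beta_gt0 : 0 < beta)
    (eps_gt0 : 0 < eps) (eps_le : eps <= beta * r ^+ 2) :
  let s := Num.sqrt (beta * r ^+ 2 / eps) in
  let n := Num.ceil (2 * s) in
  let T := (d.+1 * `|n|)%N in
  [/\ (complexity d r beta eps <= (d.+1%:R * n%:~R)%:E)%E,
      d.+1%:R * n%:~R <= 6 * d%:R * s &
      exists A : algorithm d r T,
        [/\ (worst_case_error beta A <= eps%:E)%E,
            forall (f : 'rV[R]_d -> R) (t : nat), (t < T)%N ->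
              eball r (oracle_call A f t) &
            forall f : 'rV[R]_d -> R, eball (r / 2) (output A f)]].
Proof.
move=> s n T.
have br_gt0 : 0 < beta * r ^+ 2 by rewrite mulr_gt0// exprn_gt0.
have q1 : 1 <= beta * r ^+ 2 / eps by rewrite ler_pdivlMr// mul1r.
have s1 : 1 <= s by rewrite -sqrtr1 ler_wsqrtr.
have s2 : s ^+ 2 = beta * r ^+ 2 / eps by rewrite sqr_sqrtr// (le_trans ler01).
have sn : 2 * s <= n%:~R by exact: ceil_ge.
have ns : n%:~R < 2 * s + 1 :> R.
  by have := gt_pred_ceil (2 * s); rewrite intrB -/n; lra.
have n_gt0 : 0 < n by rewrite -(ltr0z R); lra.
have nE : n%:~R = `|n|%:R :> R by rewrite natr_absz gtr0_norm.
have d1 : 1 <= d%:R :> R by rewrite ler1n.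
have d1E : d.+1%:R = d%:R + 1 :> R by rewrite natr1.
pose h := eps / (4 * d%:R * beta * r).
have c_gt0 : 0 < 4 * d%:R * beta * r by rewrite !mulr_gt0// ltr0n.
have h_gt0 : 0 < h by exact: divr_gt0.
(* From [eps <= beta * r ^+ 2] the step is at most [r / (4 * d)]. *)
have h_le : h <= r / 2.
  rewrite /h ler_pdivrMr//; apply: le_trans eps_le _.
  have -> : r / 2 * (4 * d%:R * beta * r) = 2 * d%:R * (beta * r ^+ 2) by field.
  by rewrite ler_peMl ?ltW//; lra.
pose A : algorithm d r T := zeroth_order_algorithm beta `|n|%N r_gt0 h_gt0 h_le.
have Aeps : (worst_case_error beta A <= eps%:E)%E.
  apply: ge_ereal_sup => _ [f fS <-]; rewrite lee_fin.
  have N_gt0 : (0 < `|n|)%N by rewrite absz_gt0 gt_eqF.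
  apply: le_trans (zeroth_order_algorithm_error r_gt0 h_gt0 h_le beta_gt0 N_gt0 fS) _.
  have -> : d%:R * beta * h * r = eps / 4.
    by rewrite /h; field; rewrite !gt_eqF//; lra.
  suff : beta * r ^+ 2 / (2 * `|n|%:R ^+ 2) <= eps / 8 by lra.
  rewrite -nE; have n0 : 0 < n%:~R :> R by lra.
  rewrite ler_pdivrMr ?mulr_gt0 ?exprn_gt0//.
  have -> : beta * r ^+ 2 = s ^+ 2 * eps by rewrite s2 divfK ?gt_eqF.
  have : (2 * s) ^+ 2 <= n%:~R ^+ 2 by rewrite ler_pXn2r// nnegrE; lra.
  rewrite exprMn => /(ler_wpM2r (ltW eps_gt0)); lra.
split.
- apply: ereal_inf_lbound; exists T; first by exists A.
  by rewrite /T natrM -nE.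
(* Here [d + 1 <= 2 * d], and [n < 2 * s + 1 <= 3 * s] because [s >= 1]. *)
- rewrite d1E; apply: le_trans (_ : (2 * d%:R) * (3 * s) <= _); last by lra.
  by apply: ler_pM; lra.
- exists A; split=> // [f t _|f]; [exact: eball_oracle_call|exact: eball_output].
Qed.
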